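(* Let $\mathcal A,\mathcal B\in R$. (i) Let $\mathcal A^{(1)},\mathcal B^{(1)}\in R$ be inner inverses of $\mathcal A$ and $\mathcal B$. If $\mathcal A^{(1)}*\mathcal A*\mathcal B=\mathcal B*\mathcal A^{(1)}*\mathcal A$, then $\mathcal B^{(1)}*\mathcal A^{(1)}$ is an inner inverse of $\mathcal A*\mathcal B$, i.e. $(\mathcal A*\mathcal B)^{(1)}=\mathcal B^{(1)}*\mathcal A^{(1)}$. (ii) Let $\mathcal A^{(2)},\mathcal B^{(2)}\in R$ be $\{2\}$-inverses of $\mathcal A$ and $\mathcal B$. If $\mathcal B*\mathcal B^{(2)}*\mathcal A^{(2)}=\mathcal A^{(2)}*\mathcal B*\mathcal B^{(2)}$, then $\mathcal B^{(2)}*\mathcal A^{(2)}$ is a $\{2\}$-inverse of $\mathcal A*\mathcal B$, i.e. $(\mathcal A*\mathcal B)^{(2)}=\mathcal B^{(2)}*\mathcal A^{(2)}$.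
   Context: Fix $p\ge 3$ and positive integers $n,n_3,\dots,n_p$; $R=\mathbb{R}^{n\times n\times n_3\times\cdots\times n_p}$ is the set of real tensors of this size, with entrywise addition. For $\mathcal A\in R$ let $\mathcal A_i$ ($1\le i\le n_p$) be the tensor of order $p-1$ obtained by fixing the last index at $i$. The t-product is defined recursively by $(\mathcal A*\mathcal B)_i=\sum_{j=1}^{n_p}\mathcal A_{i-j+1}*\mathcal B_j$ (indices modulo $n_p$ in $\{1,\dots,n_p\}$), where for matrices $*$ is the ordinary matrix product. With these operations $R$ is an associative ring with unity. An inner inverse $\mathcal A^{(1)}$ of $\mathcal A$ is any $\mathcal Z\in R$ with $\mathcal A*\mathcal Z*\mathcal A=\mathcal A$; a $\{2\}$-inverse $\mathcal A^{(2)}$ of $\mathcal A$ is any $\mathcal Z\in R$ with $\mathcal Z*\mathcal A*\mathcal Z=\mathcal Z$. *)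

(* Defs.v *)
From HB Require Import structures.
From mathcomp Require Import all_boot all_order all_algebra.
From mathcomp Require Import reals.

Set Implicit Arguments.
Unset Strict Implicit.
Unset Printing Implicit Defensive.

Import Order.TTheory GRing.Theory Num.Theory.
Local Open Scope ring_scope.

(* [tensor R n d q] is the additive group of real tensors of order q + 2 and
   size n x n x d(3) x ... x d(q+2): [d k] is the size of the k-th index, and
   only the values d(3), ..., d(q+2) matter.  The outermost index is the last
   one, and indices are numbered from 0. *)
Fixpoint tensor (R : realType) (n : nat) (d : nat -> nat) (q : nat) : zmodType :=
  match q with
  | 0 => 'M[R]_n
  | q'.+1 => {ffun 'I_(d q'.+3) -> tensor R n d q'}
  end.

Definition tslice (R : realType) (n : nat) (d : nat -> nat) (q : nat)
    (A : tensor R n d q.+1) (i : 'I_(d q.+3)) : tensor R n d q :=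
  (A : {ffun 'I_(d q.+3) -> tensor R n d q}) i.

Lemma ord_dim_gt0 (m : nat) (i : 'I_m) : (0 < m)%N.
Proof. exact: leq_ltn_trans (leq0n i) (ltn_ord i). Qed.

(* i - j modulo m; for indices numbered from 1 this is i - j + 1. *)
Definition ord_cycsub (m : nat) (i j : 'I_m) : 'I_m :=
  Ordinal (ltn_pmod (i + (m - j)) (ord_dim_gt0 i)).

Fixpoint tprod (R : realType) (n : nat) (d : nat -> nat) (q : nat) :
    tensor R n d q -> tensor R n d q -> tensor R n d q :=
  match q return tensor R n d q -> tensor R n d q -> tensor R n d q with
  | 0 => fun A B : 'M[R]_n => A *m B
  | q'.+1 => fun A B =>
      [ffun i : 'I_(d q'.+3) =>
        \sum_(j < d q'.+3) tprod (tslice A (ord_cycsub i j)) (tslice B j)]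
  end.

Notation "A *t B" := (tprod A B) (at level 40, left associativity) : ring_scope.

Definition inner_inverse (R : realType) (n : nat) (d : nat -> nat) (q : nat)
    (A Z : tensor R n d q) : Prop := A *t Z *t A = A.

Definition two_inverse (R : realType) (n : nat) (d : nat -> nat) (q : nat)
    (A Z : tensor R n d q) : Prop := Z *t A *t Z = Z.

(* Main.v *)
Require Import Defs.
From HB Require Import structures.
From mathcomp Require Import all_boot all_order all_algebra.
From mathcomp Require Import reals.

(** Both parts are identities of the multiplicative semigroup of tensors: they
    only rebracket products and use the commutation hypotheses.  In (i), the
    idempotent A1 A commutes with B, hence
      A B B1 (A1 A B) = A (B B1 B) A1 A = A (B A1 A) = (A A1 A) B = A B;
    in (ii), the idempotent B B2 commutes with A2, hence
      B2 A2 A (B B2 A2) = B2 (A2 A A2) B B2 = B2 (A2 B B2) = (B2 B B2) A2 = B2 A2.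

    The mathematical content is therefore the associativity of the t-product
    ([tprodA]).  By recursion on the order, the t-product is the convolution
    product of the group algebra of a cyclic group over the tensors of lower
    order.  Associativity of a convolution follows from associativity and
    distributivity of the coefficients (so distributivity is proved along the
    same recursion, [tprodDl] and [tprodDr]) and from two facts on the index
    set: translations are bijective, and i - l = (i - j) - (l - j). *)

Set Implicit Arguments.
Unset Strict Implicit.
Unset Printing Implicit Defensive.

Import Order.TTheory GRing.Theory Num.Theory.
Local Open Scope ring_scope.

(** Identifies [ord_cycsub] with the subtraction of the cyclic group Z/(m+1),
    so that the facts on indices become identities in an abelian group. *)
Lemma ord_cycsubE (m : nat) (i j : 'I_m.+1) : ord_cycsub i j = i - j.
Proof. by apply: val_inj; rewrite /= modnDmr. Qed.

Lemma ord_cycsub_inj (m : nat) (j : 'I_m) :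
  injective (fun i : 'I_m => ord_cycsub i j).
Proof.
case: m j => [|m] j i k; first by case: i.
by rewrite !ord_cycsubE => /addIr.
Qed.

Lemma ord_cycsub_cancel (m : nat) (i l j : 'I_m) :
  ord_cycsub (ord_cycsub i j) (ord_cycsub l j) = ord_cycsub i l.
Proof.
case: m i l j => [|m] i l j; first by case: i.
by rewrite !ord_cycsubE opprB addrA subrK.
Qed.

Section TensorProduct.
Variables (R : realType) (n : nat) (d : nat -> nat).
Implicit Types q : nat.

Lemma tsliceD q (A B : tensor R n d q.+1) i :
  tslice (A + B) i = tslice A i + tslice B i.
Proof. exact: ffunE. Qed.

Lemma tslice_tprod q (A B : tensor R n d q.+1) i :
  tslice (A *t B) i
  = \sum_(j < d q.+3) tslice A (ord_cycsub i j) *t tslice B j.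
Proof. exact: ffunE. Qed.

Lemma tsliceP q (A B : tensor R n d q.+1) :
  (forall i, tslice A i = tslice B i) -> A = B.
Proof. by move=> eqAB; apply/ffunP. Qed.

Lemma tprodDl q (A B C : tensor R n d q) : (A + B) *t C = A *t C + B *t C.
Proof.
elim: q A B C => [|q IHq] A B C; first exact: mulmxDl.
apply: tsliceP => i; rewrite tsliceD !tslice_tprod -big_split.
by apply: eq_bigr => j _; rewrite tsliceD IHq.
Qed.

Lemma tprodDr q (A B C : tensor R n d q) : A *t (B + C) = A *t B + A *t C.
Proof.
elim: q A B C => [|q IHq] A B C; first exact: mulmxDr.
apply: tsliceP => i; rewrite tsliceD !tslice_tprod -big_split.
by apply: eq_bigr => j _; rewrite tsliceD IHq.
Qed.

Lemma tprod0l q (A : tensor R n d q) : 0 *t A = 0.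
Proof. by apply: (addrI (0 *t A)); rewrite -tprodDl !addr0. Qed.

Lemma tprod0r q (A : tensor R n d q) : A *t 0 = 0.
Proof. by apply: (addrI (A *t 0)); rewrite -tprodDr !addr0. Qed.

Lemma tprod_suml q (I : finType) (F : I -> tensor R n d q) A :
  (\sum_i F i) *t A = \sum_i F i *t A.
Proof.
apply: (big_morph (fun X : tensor R n d q => X *t A)); last exact: tprod0l.
by move=> X Y; apply: tprodDl.
Qed.

Lemma tprod_sumr q (I : finType) (F : I -> tensor R n d q) A :
  A *t (\sum_i F i) = \sum_i A *t F i.
Proof.
apply: (big_morph (fun X : tensor R n d q => A *t X)); last exact: tprod0r.
by move=> X Y; apply: tprodDr.
Qed.

(** Both bracketings have i-th slice equal to the sum of A_a B_b C_c over
    a + b + c = i; expanding A (B C) parametrizes it by (b + c, c), expanding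
    (A B) C by (b, c). *)
Lemma tprodA q (A B C : tensor R n d q) : A *t (B *t C) = A *t B *t C.
Proof.
elim: q A B C => [|q IHq] A B C; first exact: mulmxA.
apply: tsliceP => i; rewrite !tslice_tprod.
under eq_bigr => l _ do rewrite tslice_tprod tprod_sumr.
rewrite exchange_big; apply: eq_bigr => j _ /=.
rewrite tslice_tprod tprod_suml.
(* With c = j fixed, the index b of (A B) C becomes l - j, where l = b + c. *)
rewrite [RHS](reindex_inj (@ord_cycsub_inj _ j)) /=.
by apply: eq_bigr => l _; rewrite ord_cycsub_cancel IHq.
Qed.

Lemma inner_inverse_tprod q (A B A1 B1 : tensor R n d q) :
  inner_inverse A A1 -> inner_inverse B B1 -> A1 *t A *t B = B *t A1 *t A ->
  inner_inverse (A *t B) (B1 *t A1).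
Proof.
rewrite /inner_inverse => invA invB comm.
have -> : A *t B *t (B1 *t A1) *t (A *t B) = A *t B *t B1 *t (A1 *t A *t B).
  by rewrite !tprodA.
have -> : A *t B *t B1 *t (A1 *t A *t B) = A *t (B *t B1 *t B) *t A1 *t A.
  by rewrite comm !tprodA.
have -> : A *t (B *t B1 *t B) *t A1 *t A = A *t (A1 *t A *t B).
  by rewrite invB comm !tprodA.
by rewrite !tprodA invA.
Qed.

Lemma two_inverse_tprod q (A B A2 B2 : tensor R n d q) :
  two_inverse A A2 -> two_inverse B B2 -> B *t B2 *t A2 = A2 *t B *t B2 ->
  two_inverse (A *t B) (B2 *t A2).
Proof.
rewrite /two_inverse => invA invB comm.
have -> : B2 *t A2 *t (A *t B) *t (B2 *t A2) = B2 *t A2 *t A *t (B *t B2 *t A2).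
  by rewrite !tprodA.
have -> : B2 *t A2 *t A *t (B *t B2 *t A2) = B2 *t (A2 *t A *t A2) *t B *t B2.
  by rewrite comm !tprodA.
have -> : B2 *t (A2 *t A *t A2) *t B *t B2 = B2 *t (B *t B2 *t A2).
  by rewrite invA comm !tprodA.
by rewrite !tprodA invB.
Qed.

End TensorProduct.

Theorem proposition4 (R : realType) (p n : nat) (d : nat -> nat)
    (hp : (3 <= p)%N) (hn : (0 < n)%N)
    (hd : forall k : nat, (3 <= k <= p)%N -> (0 < d k)%N)
    (A B : tensor R n d (p - 2)) :
  (forall A1 B1 : tensor R n d (p - 2),
     inner_inverse A A1 -> inner_inverse B B1 ->
     A1 *t A *t B = B *t A1 *t A ->
     inner_inverse (A *t B) (B1 *t A1))
  /\
  (forall A2 B2 : tensor R n d (p - 2),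
     two_inverse A A2 -> two_inverse B B2 ->
     B *t B2 *t A2 = A2 *t B *t B2 ->
     two_inverse (A *t B) (B2 *t A2)).
Proof.
split; first exact: inner_inverse_tprod.
exact: two_inverse_tprod.
Qed.
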